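(* Let $t$ be a positive integer and $n \geq 2t+1$. Suppose $\mathcal A \subseteq S_n$ is $t$-cycle-intersecting. Then $|\mathcal A| \leq (n-t)!$, with equality if and only if $\mathcal A$ is the stabilizer of $t$ points.
   Context: $S_n$ denotes the symmetric group on $[n]=\{1,\dots,n\}$. Two permutations have a cycle in common if that cycle appears in the cycle decompositions of both (1-cycles, i.e. fixed points, count as cycles). A family $\mathcal A\subseteq S_n$ is $t$-cycle-intersecting if any two distinct permutations in $\mathcal A$ have at least $t$ cycles in common. The stabilizer of $t$ points is a family of the form $\{\sigma\in S_n : \sigma(a_k)=a_k \text{ for } k=1,\dots,t\}$ for some distinct $a_1,\dots,a_t\in[n]$. *)

(* Defs.v *)
From mathcomp Require Import all_boot all_fingroup.

Set Implicit Arguments.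
Unset Strict Implicit.
Unset Printing Implicit Defensive.

(* A cycle of s is encoded as the pair of its underlying set C (an orbit of s)
   and the permutation that acts as s on C and fixes every point outside C.
   The set C is needed to tell the 1-cycles (x) apart, since they all have the
   identity as underlying permutation; the permutation is needed to tell apart
   different cycles on the same set, such as (1 2 3) and (1 3 2). *)
Definition cycles (n : nat) (s : 'S_n) : {set {set 'I_n} * 'S_n} :=
  [set (C, restr_perm C s) | C in porbits s].

Definition cycle_intersecting (n t : nat) (A : {set 'S_n}) : Prop :=
  forall s u : 'S_n, s \in A -> u \in A -> s != u ->
    t <= #|cycles s :&: cycles u|.

Definition pt_stabilizer (n t : nat) (a : t.-tuple 'I_n) : {set 'S_n} :=
  [set s : 'S_n | [forall k : 'I_t, s (tnth a k) == tnth a k]].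

Definition is_pt_stabilizer (n t : nat) (A : {set 'S_n}) : Prop :=
  exists2 a : t.-tuple 'I_n, uniq a & A = pt_stabilizer a.

(* Main.v *)
(* A t-cycle-intersecting family is first compressed: whenever s x = y <> x, the
   point x is split off its cycle, replacing s by s * (x y), unless that
   permutation is already present. In a family closed under this operation any
   two members share t fixed points, because a point x with s x = u x <> x can be
   turned into a fixed point of s without creating a common one. So it remains to
   bound the number of permutations whose fixed-point set lies in a
   t-intersecting family F of subsets of [n].

   This is a weighted Ahlswede-Khachatryan theorem, proved by the generating set
   method. If an optimal F contains no t-set, it may be taken upward closed and
   left-shifted. Let x be the last element on which membership in F depends, and
   L = {i < x}. Two sets E, E' of H = {E in 2^L | E + x in F, E not in F} with
   |E & E'| = t - 1 must cover L, so for i + i' = |L| + t - 1, i <> i', one may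
   drop x from the members of H of size i at the price of deleting those of size
   i', or conversely; one of the two choices enlarges the family. If 2i =
   |L| + t - 1, one drops x from the members of H_i avoiding a point z of L and
   deletes the others; for n >= 2t + 1, averaging over z shows a gain.
   Hence an optimal F contains a t-set S, and then F lies in the star of S. As
   shifting preserves sizes, this also settles the case of equality for F.

   Finally, if a compression turns a family into the stabilizer of S, nothing has
   moved: comparing the moved permutations with a full cycle on the complement of
   S gives two members of the original family with fewer than t common cycles. *)
Require Import Defs.
From mathcomp Require Import all_boot all_fingroup.
From mathcomp Require Import zify.

Set Implicit Arguments.
Unset Strict Implicit.
Unset Printing Implicit Defensive.

(** * Compression of families *)

Definition compress_elt (T : finType) (c : pred T) (f : T -> T) (A : {set T})
  (s : T) : T := if c s && (f s \notin A) then f s else s.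

Definition compress (T : finType) (c : pred T) (f : T -> T) (A : {set T}) :
  {set T} := compress_elt c f A @: A.
Arguments compress {T} c f A.

(** Moved elements land outside [A] and all others stay inside, so only two moved elements could
    collide, and [f] keeps those apart. *)
Lemma compress_elt_inj (T : finType) (c : pred T) (f : T -> T) (A : {set T}) :
  injective f -> {in A &, injective (compress_elt c f A)}.
Proof.
move=> f_inj s u sA uA; rewrite /compress_elt.
case: ifP => [/andP[_ fsA]|_]; case: ifP => [/andP[_ fuA]|_] //.
- exact: f_inj.
- by move=> eq_fs; rewrite eq_fs uA in fsA.
- by move=> eq_fu; rewrite -eq_fu sA in fuA.
Qed.

Lemma sum_compress (T : finType) (c : pred T) (f : T -> T) (A : {set T})
  (w : T -> nat) : injective f ->
  \sum_(s in compress c f A) w s = \sum_(s in A) w (compress_elt c f A s).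
Proof. by move=> f_inj; rewrite big_imset //; apply: compress_elt_inj. Qed.

Lemma card_compress (T : finType) (c : pred T) (f : T -> T) (A : {set T}) :
  injective f -> #|compress c f A| = #|A|.
Proof. by move=> f_inj; rewrite card_in_imset //; apply: compress_elt_inj. Qed.

Lemma sum_compress_lt (T : finType) (c : pred T) (f : T -> T) (A : {set T})
    (w : T -> nat) (s : T) :
    injective f -> (forall u, c u -> w u < w (f u)) ->
    s \in A -> c s -> f s \notin A ->
  \sum_(u in A) w u < \sum_(u in compress c f A) w u.
Proof.
move=> f_inj w_lt sA cs fsA; rewrite sum_compress // (bigD1 s) //=.
rewrite [X in _ < X](bigD1 s) //= -addSn leq_add //.
  by rewrite /compress_elt cs fsA w_lt.
apply: leq_sum => u _; rewrite /compress_elt.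
by case: ifP => // /andP[cu _]; apply: ltnW; apply: w_lt.
Qed.

Lemma sum_compress_eq (T : finType) (c : pred T) (f : T -> T) (A : {set T})
    (w : T -> nat) : injective f -> (forall u, w (f u) = w u) ->
  \sum_(u in compress c f A) w u = \sum_(u in A) w u.
Proof.
move=> f_inj w_eq; rewrite sum_compress //; apply: eq_bigr => u _.
by rewrite /compress_elt; case: ifP.
Qed.

(** An element [u] with [c u] stays put when [f u] is already in [A]. The last hypothesis covers
    this case: [s] is related to [f u] within [A], and [f] is carried over to the other side. *)
Lemma compress_pairwise (T : finType) (c : pred T) (f : T -> T) (A : {set T})
    (R : rel T) :
    symmetric R ->
    (forall s u, c s -> c u -> R s u -> R (f s) (f u)) ->
    (forall s u, c s -> ~~ c u -> R s u -> R (f s) u) ->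
    (forall s u, c s -> c u -> R s (f u) -> R (f s) u) ->
  {in A &, forall s u, R s u} -> {in compress c f A &, forall s u, R s u}.
Proof.
move=> R_sym R1 R2 R3 RA _ _ /imsetP[s sA ->] /imsetP[u uA ->].
have mixed s' u' : s' \in A -> u' \in A -> c s' -> ~~ (c u' && (f u' \notin A)) ->
    R (f s') u'.
  move=> s'A u'A cs'; case cu': (c u') => /=.
    by rewrite negbK => fu'A; apply: R3 => //; apply: RA.
  by move=> _; apply: R2; rewrite ?cu' //; apply: RA.
rewrite /compress_elt.
case: ifP => [/andP[cs _]|cs]; case: ifP => [/andP[cu _]|cu].
- by apply: R1 => //; apply: RA.
- by apply: mixed; rewrite ?cu.
- by rewrite R_sym; apply: mixed; rewrite ?cs.
- exact: RA.
Qed.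

(** * Counting permutations by fixed points *)

(* Number of permutations of j + r points without a fixed point among the first
   j of them. *)
Fixpoint partial_derangements (j r : nat) : nat :=
  match j with
  | 0 => r`!
  | 1 => r * r`!
  | (k.+1 as i).+1 =>
      (i + r) * partial_derangements i r + i * partial_derangements k r
  end.

(** At [j = 0] the truncated predecessor is harmless because its factor is [0]. *)
Lemma partial_derangementsS (j r : nat) : partial_derangements j.+1 r =
  (j + r) * partial_derangements j r + j * partial_derangements j.-1 r.
Proof. by case: j => [|j] //=; rewrite add0n mul0n addn0. Qed.

(** Combinatorially, the extra free point is either moved or fixed. The recurrence reaches back two
    indices, so the induction carries two consecutive cases. *)
Lemma partial_derangements_addr (j r : nat) : partial_derangements j r.+1 =
  partial_derangements j.+1 r + partial_derangements j r.
Proof.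
suff : partial_derangements j r.+1 =
         partial_derangements j.+1 r + partial_derangements j r /\
       partial_derangements j.+1 r.+1 =
         partial_derangements j.+2 r + partial_derangements j.+1 r by case.
elim: j => [|j [IH1 IH2]]; first by rewrite /= factS; split; nia.
split=> //; have E2 := partial_derangementsS j.+1 r.
have E3 := partial_derangementsS j.+2 r.
have := partial_derangementsS j.+1 r.+1.
rewrite [j.+1.-1]/= [j.+2.-1]/= in E2 E3 *; rewrite IH1 IH2 E3 => ->.
move: E2; move: (partial_derangements _ _) => A2.
move: (partial_derangements _ _) (partial_derangements _ _) => A1 A0 ->; nia.
Qed.

(** The excluded case is that of a single point, which cannot be moved. *)
Lemma partial_derangements_gt0 (j r : nat) :
  (j != 1) || (r != 0) -> 0 < partial_derangements j r.
Proof.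
suff : ((j != 1) || (r != 0) -> 0 < partial_derangements j r) /\
       ((j.+1 != 1) || (r != 0) -> 0 < partial_derangements j.+1 r) by case.
elim: j => [|j [IH1 IH2]].
  by split; rewrite /= ?fact_gt0 // muln_gt0 fact_gt0 lt0n => ->.
split=> // _; case jr: ((j != 1) || (r != 0)).
  by rewrite partial_derangementsS /= addn_gt0 [X in _ || X]muln_gt0 IH1 ?orbT.
by move: jr => /norP[/negPn/eqP-> /negPn/eqP->].
Qed.

(** The recurrence adds a multiple of the value two indices back. It is positive except when [j = 2]
    and [r = 0], where the two sides are 1 and 2. *)
Lemma partial_derangements_ltS (j r : nat) :
  0 < j -> partial_derangements j r < partial_derangements j.+1 r.
Proof.
case: j => // j _; rewrite [X in _ < X]partial_derangementsS -pred_Sn.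
case jr: ((j != 1) || (r != 0)).
  have := partial_derangements_gt0 jr.
  move: (partial_derangements j r) (partial_derangements j.+1 r) => Y X Y_gt0.
  nia.
by move: jr => /norP[/negPn/eqP-> /negPn/eqP->].
Qed.

Arguments partial_derangements : simpl never.

Definition fixpts (T : finType) (s : {perm T}) : {set T} := [set x | s x == x].

Lemma card_fixing (T : finType) (E : {set T}) :
  #|[set s : {perm T} | E \subset fixpts s]| = (#|T| - #|E|)`!.
Proof.
rewrite -(cardsC E) addKn -card_perm.
apply: eq_card => s; rewrite inE unfold_in; apply/subsetP/subsetP => sE x.
  by rewrite !inE; apply: contra => /sE; rewrite inE.
by move=> xE; have := sE x; rewrite !inE xE; case: eqP => // _ /(_ isT).
Qed.

Lemma disjointsU1 (T : finType) (x : T) (A B : {set T}) :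
  [disjoint x |: A & B] = (x \notin B) && [disjoint A & B].
Proof. by rewrite !disjoints_subset subUset sub1set inE. Qed.

(** Induction on the size of [J]: once a point [x] is taken out of [J], permutations are sorted by
    whether they fix [x], which mirrors [partial_derangements_addr]. *)
Lemma card_fixing_moving (T : finType) (E J : {set T}) : [disjoint E & J] ->
  #|[set s : {perm T} | (E \subset fixpts s) && [disjoint J & fixpts s]]| =
  partial_derangements #|J| (#|T| - (#|E| + #|J|)).
Proof.
move: {2}#|J| (erefl #|J|) => j; elim: j E J => [|j IH] E J Jj dEJ.
  rewrite Jj addn0 [RHS]/partial_derangements -card_fixing.
  apply: eq_card => s; rewrite !inE.
  by rewrite (cards0_eq Jj) disjoints_subset sub0set andbT.
have [x xJ] : exists x, x \in J by apply/card_gt0P; rewrite Jj.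
have J'j : #|J :\ x| = j by move: Jj; rewrite (cardsD1 x) xJ => -[].
have xE : x \notin E by rewrite (disjointFl dEJ xJ).
have dEJ' : [disjoint E & J :\ x] by apply: disjointWr dEJ; apply: subD1set.
have dxEJ' : [disjoint x |: E & J :\ x] by rewrite disjointsU1 setD11.
have le_T : #|E| + #|J| <= #|T|.
  by rewrite -(cardsUI E J) (disjoint_setI0 dEJ) cards0 addn0 max_card.
have := IH _ _ J'j dEJ'; have := IH _ _ J'j dxEJ'.
rewrite cardsU1 xE J'j Jj /= add1n => card_xE card_E.
rewrite Jj in le_T; move: card_E.
have -> : #|T| - (#|E| + j) = (#|T| - (#|E| + j.+1)).+1 by lia.
rewrite partial_derangements_addr.
have <- : #|T| - (#|E|.+1 + j) = #|T| - (#|E| + j.+1) by lia.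
rewrite -card_xE -(cardsID [set s : {perm T} | x \in fixpts s]) addnC.
have -> : [set s : {perm T} | (E \subset fixpts s) &&
    [disjoint J :\ x & fixpts s]] :&: [set s : {perm T} | x \in fixpts s] =
  [set s | (x |: E \subset fixpts s) && [disjoint J :\ x & fixpts s]].
  by apply/setP => s; rewrite !inE subUset sub1set inE andbC andbA.
have -> : [set s : {perm T} | (E \subset fixpts s) &&
    [disjoint J :\ x & fixpts s]] :\: [set s : {perm T} | x \in fixpts s] =
  [set s | (E \subset fixpts s) && [disjoint J & fixpts s]].
  apply/setP => s; rewrite !inE -[in RHS](setD1K xJ) disjointsU1 inE.
  by rewrite andbCA.
by move=> /eqP; rewrite eqn_add2r => /eqP.
Qed.

Lemma card_fixpts_trace (T : finType) (M E : {set T}) : E \subset M ->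
  #|[set s : {perm T} | fixpts s :&: M == E]| =
  partial_derangements (#|M| - #|E|) (#|T| - #|M|).
Proof.
move=> EM; have dE : [disjoint E & M :\: E].
  by rewrite disjoints_subset; apply/subsetP => x xE; rewrite !inE xE.
have := card_fixing_moving dE.
rewrite cardsDS // subnKC ?subset_leq_card // => <-.
apply: eq_card => s; rewrite !inE.
apply/eqP/andP => [<-|[Es dM]].
  split; first exact: subsetIl.
  rewrite disjoint_sym disjoints_subset; apply/subsetP => x xs.
  by move: xs; rewrite !inE => ->; case: (x \in M).
apply/setP => x; rewrite inE; apply/andP/idP => [[xs xM]|xE].
  apply: contraLR xs => xE; rewrite (disjointFr dM) //.
  by rewrite inE xE.
by split; [apply: (subsetP Es)|apply: (subsetP EM)].
Qed.

Definition perms_fixing_in (T : finType) (F : {set {set T}}) : {set {perm T}} :=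
  [set s | fixpts s \in F].

Lemma card_trace_in (T : finType) (M : {set T}) (H : {set {set T}}) (k : nat) :
    (forall E, E \in H -> E \subset M /\ #|E| = k) ->
  #|[set s : {perm T} | fixpts s :&: M \in H]| =
  #|H| * partial_derangements (#|M| - k) (#|T| - #|M|).
Proof.
move=> HM; rewrite -sum1_card.
rewrite (partition_big (fun s => fixpts s :&: M) (mem H)) /=; last first.
  by move=> s; rewrite inE.
rewrite -sum_nat_const; apply: eq_bigr => E EH; have [EM <-] := HM E EH.
rewrite -card_fixpts_trace // -sum1_card; apply: eq_bigl => s.
by rewrite !inE; case: eqP => [->|]; rewrite ?EH ?andbF.
Qed.

Lemma card_perms_fixing_in (T : finType) (F : {set {set T}}) :
  #|perms_fixing_in F| = \sum_(B in F) partial_derangements (#|T| - #|B|) 0.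
Proof.
rewrite -sum1_card (partition_big (@fixpts T) (mem F)) /=; last first.
  by move=> s; rewrite inE.
apply: eq_bigr => B BF; have := card_fixpts_trace (subsetT B).
rewrite cardsT subnn => <-; rewrite -sum1_card.
apply: eq_bigl => s; rewrite !inE setIT.
by case: eqP => [->|]; rewrite ?BF ?andbF.
Qed.

(** * Intersecting families of sets *)

(** The pair [B = C] is included, so every member has at least [t] elements. *)
Definition t_intersecting (T : finType) (t : nat) (F : {set {set T}}) : bool :=
  [forall B in F, forall C in F, t <= #|B :&: C|].

Lemma t_intersectingP (T : finType) (t : nat) (F : {set {set T}}) :
  reflect {in F &, forall B C, t <= #|B :&: C|} (t_intersecting t F).
Proof.
by apply: (iffP forall_inP) => [FI B C BF CF|FI B BF];
  [apply: (forall_inP (FI B BF))|apply/forall_inP => C CF; apply: FI].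
Qed.
Arguments t_intersectingP {T t F}.

Definition upclosed (T : finType) (F : {set {set T}}) : Prop :=
  forall B C : {set T}, B \in F -> B \subset C -> C \in F.

Definition left_shifted (n : nat) (F : {set {set 'I_n}}) : Prop :=
  forall (i j : 'I_n) (B : {set 'I_n}), i < j -> B \in F -> j \in B -> i \notin B ->
    i |: (B :\ j) \in F.
Arguments left_shifted {n} F.

(** Taking the image under a transposition makes this a size-preserving involution on all sets; by
    [swapE] it is the usual shift where [shift] applies it. *)
Definition swap (T : finType) (i j : T) (B : {set T}) : {set T} := tperm i j @: B.

Lemma swapK (T : finType) (i j : T) : involutive (swap i j).
Proof.
move=> B; rewrite /swap -imset_comp -[RHS]imset_id; apply: eq_imset => x /=.
exact: tpermK.
Qed.

Lemma card_swap (T : finType) (i j : T) (B : {set T}) : #|swap i j B| = #|B|.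
Proof. by rewrite card_imset //; apply: perm_inj. Qed.

Lemma swapI (T : finType) (i j : T) (B C : {set T}) :
  swap i j (B :&: C) = swap i j B :&: swap i j C.
Proof. by apply: imsetI => x y _ _; apply: perm_inj. Qed.

Lemma mem_swap (T : finType) (i j x : T) (B : {set T}) :
  (x \in swap i j B) = (tperm i j x \in B).
Proof. by rewrite -{1}(tpermK i j x) mem_imset //; apply: perm_inj. Qed.

Lemma swapE (T : finType) (i j : T) (B : {set T}) :
  j \in B -> i \notin B -> swap i j B = i |: (B :\ j).
Proof.
move=> jB iB; apply/setP => x; rewrite mem_swap !inE.
have [->|->|/eqP/negPf xi /eqP/negPf xj] := tpermP i j x.
- by rewrite eqxx jB.
- rewrite eqxx (negPf iB) /= orbF; apply/esym/negbTE.
  by apply: contraNneq iB => <-.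
- by rewrite xi xj.
Qed.

Definition shift (T : finType) (i j : T) (F : {set {set T}}) : {set {set T}} :=
  compress (fun B : {set T} => (j \in B) && (i \notin B)) (swap i j) F.

Lemma shift_t_intersecting (T : finType) (t : nat) (i j : T) (F : {set {set T}}) :
  t_intersecting t F -> t_intersecting t (shift i j F).
Proof.
move=> /t_intersectingP FI; apply/t_intersectingP.
apply: (@compress_pairwise _ _ _ _ (fun B C => t <= #|B :&: C|)) FI.
- by move=> B C; rewrite setIC.
- by move=> B C _ _; rewrite -swapI card_swap.
(* If [j] is in [C] then so is [i], since [C] fails the condition. Hence swapping carries [B :&: C]
   into [swap i j B :&: C]. *)
- move=> B C /andP[jB iB] cC; move/leq_trans; apply.
  rewrite -(card_swap i j (B :&: C)); apply: subset_leq_card.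
  apply/subsetP => x; rewrite !(mem_swap, inE) => /andP[xB xC].
  rewrite xB /=; move: xB xC; have [->|->|//] := tpermP i j x.
    by move=> _ jC; move: cC; rewrite jC negbK.
  by rewrite (negPf iB).
- by move=> B C _ _; rewrite -(card_swap i j (B :&: _)) swapI swapK.
Qed.

Lemma card_perms_fixing_in_shift (T : finType) (i j : T) (F : {set {set T}}) :
  #|perms_fixing_in (shift i j F)| = #|perms_fixing_in F|.
Proof.
rewrite !card_perms_fixing_in sum_compress_eq //.
  exact: inv_inj (swapK i j).
by move=> B; rewrite card_swap.
Qed.

(** A sum of indicators, so that [sum_compress_eq] applies. *)
Definition num_of_size (T : finType) (k : nat) (F : {set {set T}}) : nat :=
  \sum_(B in F) (#|B| == k).

Lemma num_of_size_shift (T : finType) (k : nat) (i j : T) (F : {set {set T}}) :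
  num_of_size k (shift i j F) = num_of_size k F.
Proof.
apply: sum_compress_eq; first exact: inv_inj (swapK i j).
by move=> B; rewrite card_swap.
Qed.

Lemma shift_all_size (T : finType) (p : pred nat) (i j : T) (F : {set {set T}}) :
  {in F, forall B : {set _}, p #|B|} ->
  {in shift i j F, forall B : {set _}, p #|B|}.
Proof.
move=> pF _ /imsetP[B BF ->]; rewrite /compress_elt.
by case: ifP => _; rewrite ?card_swap; apply: pF.
Qed.

(** * Extremal families *)

Definition maximal_t_intersecting (T : finType) (t : nat) (F : {set {set T}}) :=
  t_intersecting t F /\
  forall G : {set {set T}}, t_intersecting t G ->
    #|perms_fixing_in G| <= #|perms_fixing_in F|.

(* [extremal_num] breaks the only tie in the exchange argument: for t = 3 and
   n = 7, trading 5-sets for 4-sets may leave the number of permutations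
   unchanged. *)
Record extremal (n t : nat) (F : {set {set 'I_n}}) : Prop := Extremal {
  extremal_max : maximal_t_intersecting t F;
  extremal_size : {in F, forall B : {set _}, t < #|B|};
  extremal_num : forall G : {set {set 'I_n}}, t_intersecting t G ->
    {in G, forall B : {set _}, t < #|B|} ->
    #|perms_fixing_in G| = #|perms_fixing_in F| ->
    num_of_size t.+1 G <= num_of_size t.+1 F;
  extremal_up : upclosed F;
  extremal_shift : left_shifted F }.

Lemma leq_sum_subset (T : finType) (F G : {set T}) (w : T -> nat) :
  F \subset G -> \sum_(B in F) w B <= \sum_(B in G) w B.
Proof.
move=> FG; rewrite [X in _ <= X](big_setID F) /= (setIidPr FG).
exact: leq_addr.
Qed.

(** Among the families with as many permutations as [F0] and all members larger than [t], one
    maximizes lexicographically the number of [t.+1]-sets and then [psi]. Adding a superset of a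
    member or performing a proper left shift would raise [psi]. *)
Lemma extremal_exists (n t : nat) (F0 : {set {set 'I_n}}) :
    maximal_t_intersecting t F0 -> {in F0, forall B : {set _}, t < #|B|} ->
  exists F : {set {set 'I_n}}, extremal t F.
Proof.
move=> [F0I F0max] F0t.
(* The term [n - z] rewards small elements, and the successor makes every added set count. *)
pose w (B : {set 'I_n}) := (\sum_(z in B) (n - z)).+1.
pose psi (F : {set {set 'I_n}}) := \sum_(B in F) w B.
pose K := (psi setT).+1.
have psiK F : psi F < K by rewrite ltnS; apply/leq_sum_subset/subsetT.
(* As [K] exceeds every value of [psi], this encodes the lexicographic order. *)
pose Phi F := num_of_size t.+1 F * K + psi F.
pose ok (F : {set {set 'I_n}}) :=
  [&& t_intersecting t F, [forall B in F, t < #|B|] &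
    #|perms_fixing_in F| == #|perms_fixing_in F0|].
have ok0 : ok F0 by rewrite /ok F0I eqxx andbT; apply/forall_inP.
case: (arg_maxnP Phi ok0) => F /and3P[FI /forall_inP Ft /eqP cardF] Fmax.
have Fmax' (G : {set {set 'I_n}}) : t_intersecting t G ->
    {in G, forall B : {set _}, t < #|B|} ->
    #|perms_fixing_in F| <= #|perms_fixing_in G| ->
    (num_of_size t.+1 F < num_of_size t.+1 G) ||
    (num_of_size t.+1 F <= num_of_size t.+1 G) && (psi F < psi G) -> False.
  move=> GI Gt cardG.
  have := Fmax G; rewrite /ok GI eqn_leq F0max // -cardF cardG /= andbT.
  have -> : [forall B in G, t < #|B|] by apply/forall_inP.
  move=> /(_ isT); rewrite /Phi; have := psiK F; have := psiK G.
  move: (num_of_size _ _) (num_of_size _ _) (psi _) (psi _); nia.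
exists F; split => //.
- by split=> // G GI; rewrite cardF; apply: F0max.
- move=> G GI Gt cardG; rewrite leqNgt; apply/negP => lt_FG.
  by apply: (Fmax' G) => //; rewrite ?cardG ?lt_FG.
- move=> B C BF BC; apply/negPn/negP => CF; apply: (Fmax' (C |: F)).
  + apply/t_intersectingP => D E.
    have le1 D' : D' \in F -> t <= #|C :&: D'|.
      move=> D'F; apply: leq_trans (t_intersectingP FI _ _ BF D'F) _.
      by apply/subset_leq_card/setSI.
    have leC : t <= #|C :&: C|.
      by rewrite setIid ltnW // (leq_trans (Ft _ BF)) // subset_leq_card.
    case/setU1P => [->|DF]; case/setU1P => [->|EF] //; first exact: le1.
      by rewrite setIC le1.
    exact: (t_intersectingP FI).
  + move=> D /setU1P[->|/Ft//].
    by rewrite (leq_trans (Ft _ BF)) // subset_leq_card.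
  + by apply/subset_leq_card/subsetP => s; rewrite !inE => ->; rewrite orbT.
  + apply/orP; right; rewrite leq_sum_subset ?subsetUr //=.
    by rewrite /psi big_setU1 //= /w addSn ltnS leq_addl.
- move=> i j B ij BF jB iB; apply/negPn/negP => B'F.
  apply: (Fmax' (shift i j F)).
  + exact: shift_t_intersecting.
  + exact: shift_all_size.
  + by rewrite card_perms_fixing_in_shift.
  + rewrite num_of_size_shift leqnn /= ltnn /=.
    apply: (@sum_compress_lt _ _ _ _ _ B) => //.
    * exact: inv_inj (swapK i j).
    * move=> C /andP[jC iC]; rewrite swapE // /w ltnS big_setU1 /=; last first.
        by rewrite !inE (negPf iC) andbF.
      rewrite (big_setD1 j) //= ltn_add2r.
      by have := ltn_ord j; lia.
    * by rewrite jB.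
    * by rewrite swapE.
Qed.

(** * Exchanging boundary sets *)

(** The family [H] of the overview. *)
Definition boundary (T : finType) (F : {set {set T}}) (L : {set T}) (x : T) :
  {set {set T}} := [set E : {set T} | [&& E \subset L, x |: E \in F & E \notin F]].

(** The element [x] is dropped from the boundary sets in [P] at the price of deleting those in [Q].
    Only traces on [x |: L] are tested, since [F] will depend on nothing else. *)
Definition exchange (T : finType) (F : {set {set T}}) (L : {set T}) (x : T)
    (P Q : {set {set T}}) : {set {set T}} :=
  [set B : {set T} |
    (B \in F) && (B :&: (x |: L) \notin [set x |: E | E : {set T} in Q]) ||
    (B :&: (x |: L) \in P)].

(** Only a new trace [E] in [P] needs care; let [G] be the other trace. If [x] is not in [G], or
    [G :\ x] is in [F], then [x |: E] already meets that member of [F] in [t] elements other than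
    [x]. Otherwise [G] is in [P], or [G :\ x] is a boundary set outside [Q], and the hypothesis on
    [P] applies. *)
Lemma exchange_t_intersecting (T : finType) (t : nat) (F : {set {set T}})
    (L : {set T}) (x : T) (P Q : {set {set T}}) :
    t_intersecting t F -> x \notin L ->
    {in F, forall B : {set T}, B :&: (x |: L) \in F} ->
    P \subset boundary F L x :\: Q ->
    {in P & boundary F L x :\: Q, forall E E' : {set T}, t <= #|E :&: E'|} ->
  t_intersecting t (exchange F L x P Q).
Proof.
move=> /t_intersectingP FI xL FM PH PI; set M := x |: L in FM *.
have main (B C : {set T}) : B :&: M \in P -> C \in exchange F L x P Q ->
    t <= #|B :&: C|.
  move=> BP CX; apply: (@leq_trans #|(B :&: M) :&: (C :&: M)|); last first.
    by apply/subset_leq_card/setISS; apply: subsetIl.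
  have GM : C :&: M \subset M by apply: subsetIr.
  have CG : (C :&: M \in F) && (C :&: M \notin [set x |: E | E : {set T} in Q]) ||
      (C :&: M \in P).
    by move: CX; rewrite inE => /orP[/andP[/FM-> ->]|->]; rewrite ?orbT.
  move: (B :&: M) (C :&: M) BP GM CG => E G EP GM CG {B C CX}.
  have := subsetP PH _ EP; rewrite !inE => /and4P[EQ EL xEF EF].
  have xE : x \notin E by apply: contra xL => /(subsetP EL).
  case/orP: CG => [/andP[GF GQ]|GP]; last by apply: PI => //; apply: (subsetP PH).
  case xG: (x \in G); last first.
    apply: leq_trans (FI _ _ xEF GF) (subset_leq_card _).
    apply/subsetP => y; rewrite !in_setI in_setU1 => /andP[/orP[/eqP->|->//]].
    by rewrite xG.
  have sub_xE : (x |: E) :&: (G :\ x) \subset E :&: G.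
    apply/subsetP => y; rewrite in_setI in_setU1 in_setD1 in_setI.
    by case: eqP => //= _ /andP[-> ->].
  have xGx : x |: (G :\ x) = G by rewrite setD1K.
  case G'F: (G :\ x \in F).
    by apply: leq_trans (FI _ _ xEF G'F) (subset_leq_card sub_xE).
  have G'L : G :\ x \subset L.
    apply/subsetP => y; rewrite in_setD1 => /andP[yx /(subsetP GM)].
    by rewrite in_setU1 (negPf yx).
  apply: leq_trans (PI E (G :\ x) EP _) _.
    rewrite 2!inE G'L xGx GF G'F /= andbT.
    by apply: contra GQ => G'Q; rewrite -xGx; apply: imset_f.
  by apply/subset_leq_card/setIS/subD1set.
apply/t_intersectingP => B C BX CX.
case BP: (B :&: M \in P); first exact: main.
case CP: (C :&: M \in P); first by rewrite setIC main.
move: BX CX; rewrite !inE -/M BP CP !orbF => /andP[BF _] /andP[CF _].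
exact: FI.
Qed.

(** Upward closure puts all deleted permutations in the old family, and the new ones lie outside it.
    The additive form avoids truncated subtraction. *)
Lemma card_perms_exchange (T : finType) (F : {set {set T}})
    (L : {set T}) (x : T) (P Q : {set {set T}}) :
    upclosed F -> {in F, forall B : {set T}, B :&: (x |: L) \in F} ->
    P \subset boundary F L x -> Q \subset boundary F L x ->
  #|perms_fixing_in (exchange F L x P Q)| +
    #|[set s | fixpts s :&: (x |: L) \in [set x |: E | E : {set T} in Q]]| =
  #|perms_fixing_in F| + #|[set s | fixpts s :&: (x |: L) \in P]|.
Proof.
move=> Fup FM PH QH; set M := x |: L in FM *.
set SQ := [set s | _ \in imset _ _]; set SP := [set s | _].
have SQF : SQ \subset perms_fixing_in F.
  apply/subsetP => s; rewrite !inE => /imsetP[E EQ def_E].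
  have := subsetP QH _ EQ; rewrite inE => /and3P[_ xEF _].
  by apply: Fup xEF _; rewrite -def_E subsetIl.
have SPF : [disjoint perms_fixing_in F & SP].
  rewrite disjoints_subset; apply/subsetP => s; rewrite !inE => sF.
  apply/negP => /(subsetP PH); rewrite inE => /and3P[_ _].
  by rewrite FM.
have -> : perms_fixing_in (exchange F L x P Q) = (perms_fixing_in F :\: SQ) :|: SP.
  by apply/setP => s; rewrite !inE -/M andbC.
rewrite cardsU (_ : _ :&: SP = set0) ?cards0 ?subn0; last first.
  by apply: disjoint_setI0; apply: disjointWl SPF; apply: subsetDl.
by rewrite cardsDS // addnAC subnK // subset_leq_card.
Qed.

Lemma star_t_intersecting (T : finType) (S : {set T}) :
  t_intersecting #|S| [set B : {set T} | S \subset B].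
Proof.
apply/t_intersectingP => B C; rewrite !inE => SB SC.
by apply: subset_leq_card; rewrite subsetI SB.
Qed.

Lemma card_perms_star (T : finType) (S : {set T}) :
  #|perms_fixing_in [set B : {set T} | S \subset B]| = (#|T| - #|S|)`!.
Proof. by rewrite -card_fixing; apply: eq_card => s; rewrite !inE. Qed.

Lemma exists_set_of_card (T : finType) (k : nat) :
  k <= #|T| -> exists S : {set T}, #|S| = k.
Proof.
move=> kT; exists [set x in take k (enum T)].
rewrite cardsE; move/card_uniqP: (take_uniq k (enum_uniq T)) => ->.
by rewrite size_take_min -cardT (minn_idPl kT).
Qed.

Lemma maximal_card_ge (T : finType) (t : nat) (F : {set {set T}}) :
    t <= #|T| -> maximal_t_intersecting t F ->
  (#|T| - t)`! <= #|perms_fixing_in F|.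
Proof.
move=> tT [_ Fmax]; have [S cardS] := exists_set_of_card tT.
by rewrite -cardS -card_perms_star Fmax // -cardS star_t_intersecting.
Qed.

Lemma remove_independent (T : finType) (F : {set {set T}}) (Z : {set T}) :
    (forall z B, z \in Z -> B \in F -> B :\ z \in F) ->
  {in F, forall B : {set T}, B :\: Z \in F}.
Proof.
move=> FZ B; move: {2}#|_| (leqnn #|B :&: Z|) => k.
elim: k B => [|k IH] B.
  rewrite leqn0 cards_eq0 setI_eq0 => BZ BF.
  by move/setDidPl: BZ => ->.
case: (set_0Vmem (B :&: Z)) => [BZ|[z]].
  by move=> _; apply: IH; rewrite BZ cards0.
move=> zBZ cardB BF; have := zBZ; rewrite inE => /andP[zB zZ].
have -> : B :\: Z = (B :\ z) :\: Z.
  by apply/setP => y; rewrite !inE; case: eqP => //= ->; rewrite zZ.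
apply: IH; last exact: FZ.
rewrite setIDAC; move: cardB.
by rewrite (cardsD1 z) zBZ.
Qed.

(** The inequality behind the averaging in the middle case: a set of [(a + t).-1] elements of [L]
    misses [a] of them. It follows from [(a + t).-1 <= a * (a + r)] and the recurrence, whose second
    term gives strictness unless [a = 2] and [r = 0]. *)
Lemma partial_derangements_middle (a t r : nat) : 0 < a -> t < 2 * a + r ->
  (a + t).-1 * partial_derangements a r < a * partial_derangements a.+1 r \/
  [/\ a = 2, r = 0 & (a + t).-1 * partial_derangements a r <=
                     a * partial_derangements a.+1 r].
Proof.
move=> a_gt0 tar; have le_at : (a + t).-1 <= a * (a + r).
  by case: a a_gt0 tar => [|[|b]] // _; nia.
have le_v := leq_mul le_at (leqnn (partial_derangements a r)).
rewrite partial_derangementsS mulnDr mulnA mulnA.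
case ar: ((a.-1 != 1) || (r != 0)).
  by left; have := partial_derangements_gt0 ar; nia.
move: ar => /norP[/negPn/eqP a2 /negPn/eqP r0]; right.
by split=> //; [lia|apply: leq_trans le_v (leq_addr _ _)].
Qed.

Lemma num_of_sizeE (T : finType) (k : nat) (F : {set {set T}}) :
  num_of_size k F = #|[set B in F | #|B| == k]|.
Proof.
rewrite -sum1_card /num_of_size big_mkcond [RHS]big_mkcond /=.
by apply: eq_bigr => B _; rewrite inE; case: (B \in F); case: eqP.
Qed.

(** Maximality of [F] against the exchanged family. A new trace leaves [x] to be moved as well,
    whence the successor on the left. The bracket is the gain from [extremal_num]: when it is 1, a
    tie would give more [t.+1]-sets. *)
Lemma leq_card_exchange (n t i i' : nat) (F : {set {set 'I_n}})
    (L : {set 'I_n}) (x : 'I_n) (P Q : {set {set 'I_n}}) :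
    extremal t F -> x \notin L ->
    {in F, forall B : {set 'I_n}, B :&: (x |: L) \in F} ->
    P \subset boundary F L x -> Q \subset boundary F L x -> [disjoint P & Q] ->
    {in P & boundary F L x :\: Q, forall E E' : {set _}, t <= #|E :&: E'|} ->
    {in P, forall E : {set 'I_n}, #|E| = i} ->
    {in Q, forall E : {set 'I_n}, #|E| = i'} ->
  #|P| * partial_derangements (#|L| - i).+1 (n - #|L|.+1) +
    [&& P != set0, i == t.+1 & t < i'] <=
  #|Q| * partial_derangements (#|L| - i') (n - #|L|.+1).
Proof.
move=> [[FI Fmax] Ft Fnum Fup _] xL FM PH QH dPQ PI Pi Qi.
have PHQ : P \subset boundary F L x :\: Q.
  apply/subsetP => E EP; rewrite inE (subsetP PH) // andbT.
  by rewrite (disjointFr dPQ).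
have XI := exchange_t_intersecting FI xL FM PHQ PI.
have cardM : #|x |: L| = #|L|.+1 by rewrite cardsU1 xL.
have inL E : E \in boundary F L x -> E \subset L.
  by rewrite inE => /andP[].
have := card_perms_exchange Fup FM PH QH.
rewrite (@card_trace_in _ _ P i) => [|E EP]; last first.
  split; last exact: Pi.
  by apply: subset_trans (subsetUr _ _); apply/inL/(subsetP PH).
rewrite (@card_trace_in _ _ _ i'.+1) => [|_ /imsetP[E EQ ->]]; last first.
  have EL := inL _ (subsetP QH _ EQ).
  split; first exact: setUS.
  rewrite cardsU1 Qi // (_ : x \notin E) //.
  by apply: contra xL; apply: (subsetP EL).
rewrite card_in_imset; last first.
  move=> E E' EQ E'Q eqE; have xE := contra (subsetP (inL _ (subsetP QH _ EQ)) x) xL.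
  have xE' := contra (subsetP (inL _ (subsetP QH _ E'Q)) x) xL.
  by rewrite -(setU1K xE) eqE setU1K.
rewrite cardM subSS card_ord => eqX.
have [P0|P0] := altP (P =P set0); first by rewrite P0 cards0 mul0n.
have [E0 E0P] := set0Pn _ P0.
have iL : i <= #|L|.
  by rewrite -(Pi _ E0P); apply/subset_leq_card/inL/(subsetP PH).
rewrite subSn // in eqX; have leXF := Fmax _ XI.
rewrite -(leq_add2l #|perms_fixing_in F|) addnA -eqX [X in X <= _]addnAC leq_add2r.
move: leXF.
case: (altP andP) => [[/= _ /andP[/eqP i_t t_i']]|_]; last by rewrite addn0.
rewrite addn1 leq_eqVlt => /orP[/eqP eqFX|//].
have Xt : {in exchange F L x P Q, forall B : {set 'I_n}, t < #|B|}.
  move=> B; rewrite inE => /orP[/andP[/Ft//]|BP].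
  apply: (@leq_trans #|B :&: (x |: L)|); first by rewrite (Pi _ BP) i_t.
  by apply/subset_leq_card/subsetIl.
have := Fnum _ XI Xt eqFX; rewrite leqNgt => /negP[].
have E0H := subsetP PH _ E0P.
have xE0 : E0 :&: (x |: L) = E0.
  by apply/setIidPl/(subset_trans (inL _ E0H))/subsetUr.
(* Every deleted set has at least [i'.+1 > t.+1] elements, so no [t.+1]-set is lost, while [E0] is
   gained. *)
rewrite !num_of_sizeE; apply/proper_card/properP; split.
  apply/subsetP => B; rewrite !inE => /andP[BF /eqP cardB].
  rewrite cardB eqxx BF andbT /=; apply/orP; left.
  apply: contraL t_i' => /imsetP[E EQ def_E]; rewrite -leqNgt -ltnS -cardB.
  apply: leq_trans (subset_leq_card (subsetIl B (x |: L))).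
  rewrite def_E cardsU1 (Qi _ EQ) (contra (subsetP (inL _ (subsetP QH _ EQ)) x)) //.
exists E0; first by rewrite !inE xE0 E0P orbT Pi // i_t eqxx.
by move: E0H; rewrite !inE => /and3P[_ _ /negPf->].
Qed.

(** * The last relevant element and the bound for set families *)

(** If no element mattered, a member could be emptied inside [F], against [0 < t]. For the largest
    [x] that matters, all later elements can be removed freely. *)
Lemma last_dependence (n t : nat) (F : {set {set 'I_n}}) :
    0 < t -> F != set0 -> t_intersecting t F -> upclosed F ->
  exists x : 'I_n,
    boundary F [set i : 'I_n | i < x] x != set0 /\
    {in F, forall B : {set 'I_n}, B :&: (x |: [set i : 'I_n | i < x]) \in F}.
Proof.
move=> t_gt0 /set0Pn[B0 B0F] FI Fup.
pose dep (z : 'I_n) := [exists B in F, (z \in B) && (B :\ z \notin F)].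
have depN z B : ~~ dep z -> B \in F -> B :\ z \in F.
  move=> /exists_inPn/(_ B) dz BF; have [zB|zB] := boolP (z \in B).
    by move: (dz BF); rewrite zB negbK.
  by rewrite (setDidPl _) // disjoint_sym disjoints1.
have [z0 z0dep] : exists z, dep z.
  have [z dz|nodep] := pickP dep; first by exists z.
  have : B0 :\: setT \in F.
    by apply: remove_independent B0F => z B _; apply: depN; rewrite nodep.
  rewrite setDT => F0; have := t_intersectingP FI _ _ F0 F0.
  by rewrite setIid cards0 leqNgt t_gt0.
case: (arg_maxnP (fun z : 'I_n => z : nat) z0dep) => x xdep xmax.
exists x; set L := [set i : 'I_n | i < x].
have FM : {in F, forall B : {set 'I_n}, B :&: (x |: L) \in F}.
  move=> B BF; have -> : B :&: (x |: L) = B :\: [set i : 'I_n | x < i].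
    apply/setP => y; rewrite !inE andbC -leqNgt (leq_eqVlt y x).
    by rewrite -(inj_eq val_inj).
  apply: remove_independent BF => z C; rewrite inE => xz; apply: depN.
  by apply: contraL xz => /xmax; rewrite -leqNgt.
split=> //; have [B BF /andP[xB BxF]] := exists_inP xdep.
apply/set0Pn; exists (B :&: L); rewrite inE subsetIr /=; apply/andP; split.
  rewrite (_ : x |: _ = B :&: (x |: L)) ?FM //.
  by rewrite setUIr (setUidPr _) ?sub1set.
apply: contra BxF => /Fup; apply; apply/subsetP => y; rewrite !inE.
by case/andP=> -> lt_yx; rewrite andbT; apply: contraTneq lt_yx => ->; rewrite ltnn.
Qed.

(** Restoring [x] gives at least [t] common elements, so [E] and [E'] share at least [t - 1]. If
    they share exactly that many and both miss some [z] in [L], shifting [x] to [z] in [x |: E]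
    gives a member of [F] meeting [x |: E'] in only [t - 1] elements. *)
Lemma boundary_intersection (n t : nat) (F : {set {set 'I_n}}) (x : 'I_n)
    (L := [set i : 'I_n | i < x]) (E E' : {set 'I_n}) :
    t_intersecting t F -> left_shifted F ->
    E \in boundary F L x -> E' \in boundary F L x ->
  t <= #|E :&: E'| \/ (#|E| + #|E'|).+1 = #|L| + t /\ L \subset E :|: E'.
Proof.
move=> /t_intersectingP FI Fsh; rewrite !inE.
case/and3P=> EL xEF _ /and3P[E'L xE'F _].
have [|ltI] := leqP t #|E :&: E'|; [by left|right].
have xL : x \notin L by rewrite inE ltnn.
have xE : x \notin E by apply: contra xL; apply: (subsetP EL).
have xE' : x \notin E' by apply: contra xL; apply: (subsetP E'L).
have cardI : #|E :&: E'|.+1 = t.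
  apply/eqP; rewrite eqn_leq ltI.
  have := FI _ _ xEF xE'F; rewrite -setUIr cardsU1 inE (negPf xE) /=.
  by rewrite add1n.
have LEE' : L \subset E :|: E'.
  apply/subsetP => z zL; apply/negPn/negP; rewrite inE negb_or => /andP[zE zE'].
  have zx : z != x by apply: contraNneq xL => <-.
  have zEF : z |: E \in F.
    rewrite -[E](setU1K xE); apply: Fsh => //.
    - by rewrite inE in zL.
    - exact: setU11.
    - by rewrite in_setU1 (negPf zx).
  have := FI _ _ zEF xE'F; rewrite leqNgt => /negP[].
  apply: leq_ltn_trans ltI; apply/subset_leq_card/subsetP => y.
  rewrite !inE => /andP[/orP[/eqP->|yE] /orP[/eqP yx|yE']].
  - by rewrite yx eqxx in zx.
  - by rewrite yE' in zE'.
  - by rewrite -yx yE in xE.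
  - by rewrite yE.
split=> //; rewrite -cardsUI -cardI addnS; congr (_ + _).+1.
by apply: eq_card => y; apply/idP/idP; apply/subsetP; rewrite // subUset EL.
Qed.

Lemma double_count (T U : finType) (A : {set T}) (B : {set U})
    (R : T -> U -> bool) :
  \sum_(z in A) #|[set y in B | R z y]| = \sum_(y in B) #|[set z in A | R z y]|.
Proof.
have card_sum (V : finType) (C : {set V}) (S : pred V) :
    #|[set y in C | S y]| = \sum_(y in C) S y.
  rewrite -sum1_card big_mkcond [RHS]big_mkcond; apply: eq_bigr => y _.
  by rewrite inE; case: (y \in C); case: (S y).
under eq_bigr => z _ do rewrite card_sum.
by rewrite exchange_big; apply: eq_bigr => y _; rewrite card_sum.
Qed.

Lemma no_extremal (n t : nat) (F : {set {set 'I_n}}) :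
  0 < t -> 2 * t + 1 <= n -> ~ extremal t F.
Proof.
move=> t_gt0 n_t exF; have [[FI Fmax] Ft _ Fup Fsh] := exF.
have tn : t <= #|'I_n| by rewrite card_ord; lia.
have Fcard := maximal_card_ge tn (conj FI Fmax); rewrite card_ord in Fcard.
have F0 : F != set0.
  apply: contraTneq Fcard => ->; rewrite -ltnNge; apply: leq_ltn_trans (fact_gt0 _).
  by rewrite leqn0 cards_eq0; apply/eqP/setP => s; rewrite !inE.
have [x [H0 FM]] := last_dependence t_gt0 F0 FI Fup.
set L := [set i : 'I_n | i < x] in H0 FM; set H := boundary F L x in H0.
have HI E E' : E \in H -> E' \in H ->
    t <= #|E :&: E'| \/ (#|E| + #|E'|).+1 = #|L| + t /\ L \subset E :|: E'.
  exact: boundary_intersection.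
have xL : x \notin L by rewrite inE ltnn.
have HL E : E \in H -> E \subset L by rewrite inE => /andP[].
have Hsz E : E \in H -> t <= #|E| <= #|L|.
  move=> EH; rewrite (subset_leq_card (HL E EH)) andbT.
  move: EH; rewrite inE => /and3P[EL xEF _].
  have := Ft _ xEF; rewrite cardsU1 (contra (subsetP EL x)) //.
have Ln : #|L| < n.
  have := max_card (mem (x |: L)); rewrite cardsU1 xL card_ord add1n //.
pose Hi (j : nat) := [set E in H | #|E| == j].
have HiH i : Hi i \subset H by apply/subsetP => E; rewrite inE => /andP[].
have Hi_card i : {in Hi i, forall E : {set 'I_n}, #|E| = i}.
  by move=> E; rewrite inE => /andP[_ /eqP].
set l := #|L| in Hsz Ln.
set v := partial_derangements; set r := n - l.+1.
have [E0 E0H] := set0Pn _ H0; pose i := #|E0|.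
have /andP[ti il] : t <= i <= l by apply: Hsz.
have h_gt0 : 0 < #|Hi i| by apply/card_gt0P; exists E0; rewrite inE E0H /=.
(* The only size of a boundary set that can meet one of size [i] in fewer than [t] elements. *)
pose i' := (l + t).-1 - i.
have [ii'|ii'] := eqVneq i i'; last first.
  have dH : [disjoint Hi i & Hi i'].
    rewrite disjoints_subset; apply/subsetP => E; rewrite !inE.
    by move=> /andP[_ /eqP->]; rewrite negb_and ii' orbT.
  have cross j j' : (j + j').+1 = l + t ->
      {in Hi j & H :\: Hi j', forall E E' : {set 'I_n}, t <= #|E :&: E'|}.
    move=> jj' E E' /setIdP[EH /eqP Ej] /setDP[E'H E'j'].
    have [//|[sumE _]] := HI _ _ EH E'H.
    by move: E'j'; rewrite inE E'H -(eqn_add2l j) -{1}Ej -eqSS sumE jj' eqxx.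
  have X1 := leq_card_exchange exF xL FM (HiH i) (HiH i') dH
    (cross i i' ltac:(rewrite /i'; lia)) (Hi_card i) (Hi_card i').
  have X2 := leq_card_exchange exF xL FM (HiH i') (HiH i)
    (etrans (disjoint_sym _ _) dH)
    (cross i' i ltac:(rewrite /i'; lia)) (Hi_card i') (Hi_card i).
  rewrite -/l -/r -/v in X1 X2.
  have V2 : v (l - i') r < v (l - i').+1 r.
    by apply: partial_derangements_ltS; rewrite /i'; lia.
  have [h'0|h'_gt0] := posnP #|Hi i'|.
    (* With nothing to delete the exchange is free, so the added traces carry no permutation. This
       forces [E0 = L] and [x |: L = setT]; then each member of [F] contains [x], and by shifting
       every other point, leaving only the identity. *)
    have v0 : v (l - i).+1 r = 0 by rewrite h'0 in X1; move: X1 h_gt0; nia.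
    have : (l - i == 0) && (r == 0).
      apply/negPn/negP => lr.
      have := @partial_derangements_gt0 (l - i).+1 r.
      rewrite eqSS -negb_and lr -/v v0 => /(_ isT) //.
    move=> /andP[li0 r0].
    have E0L : E0 = L.
      by apply/eqP; rewrite eqEcard HL //= -/l -/i; lia.
    have LF : L \notin F by move: E0H; rewrite inE E0L => /and3P[].
    have xLT : x |: L = setT.
      by apply/eqP; rewrite eqEcard subsetT cardsT card_ord cardsU1 xL; lia.
    have xF B : B \in F -> x \in B.
      move=> BF; apply: contraR LF => xB; apply: (Fup B) => //.
      apply/subsetP => y yB; have := in_setT y; rewrite -xLT in_setU1.
      by case/orP => // /eqP yx; rewrite -yx yB in xB.
    have FT B : B \in F -> B = setT.
      move=> BF; apply/setP => y; rewrite in_setT; apply: contraNT LF => yB.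
      have yx : y != x by apply: contraNneq yB => ->; apply: xF.
      have yL : y \in L.
        by have := in_setT y; rewrite -xLT in_setU1 (negPf yx).
      have : y |: (B :\ x) \in F by apply: Fsh => //; [rewrite inE in yL|apply: xF].
      by move/xF; rewrite !inE eqxx (eq_sym x y) (negPf yx).
    have : #|perms_fixing_in F| <= 1.
      rewrite -(cards1 (1%g : 'S_n)); apply/subset_leq_card/subsetP => s.
      rewrite !inE => /FT sT; apply/eqP/permP => y; rewrite perm1.
      by have := in_setT y; rewrite -sT inE => /eqP.
    move/(leq_trans Fcard); apply/negP; rewrite -ltnNge.
    by apply: leq_trans (fact_geq _); lia.
  have [E1 E1H] := card_gt0P h'_gt0.
  have V1 : v (l - i) r < v (l - i).+1 r.
    apply: partial_derangements_ltS.
    have /andP[] := Hsz E1 (subsetP (HiH _) _ E1H).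
    by rewrite (Hi_card _ _ E1H) /i'; lia.
  (* With [h], [h'] the sizes of [Hi i], [Hi i']: [h * v (l - i).+1 r <= h' * v (l - i') r < h' * v
     (l - i').+1 r <= h * v (l - i) r], against [V1]. *)
  move: X1 X2 V1 V2 h_gt0 h'_gt0.
  move: (v _ _) (v _ _) (v _ _) (v _ _) => a b c d.
  case: (_ && _); case: (_ && _) => /=; nia.
pose a := l - i.
have [la ia] : l = i + a /\ i = (a + t).-1.
  by rewrite /a; move: ii'; rewrite /i'; lia.
have a_gt0 : 0 < a by rewrite /a; move: ii'; rewrite /i'; lia.
have i2 : (i + i).+1 = l + t by move: ii'; rewrite /i'; lia.
(* Here [n = t + 2 * a + r], so this is the hypothesis [2 * t + 1 <= n]. *)
have tar : t < 2 * a + r by rewrite /r; lia.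
pose P (z : 'I_n) := [set E in Hi i | z \notin E].
pose Q (z : 'I_n) := [set E in Hi i | z \in E].
(* Two sets of size [i] that both miss [z] cannot cover [L], so they share [t] elements. *)
have X z : z \in L -> #|P z| * v a.+1 r + [&& P z != set0, i == t.+1 & t < i] <=
    #|Q z| * v a r.
  move=> zL.
  have PH : P z \subset H.
    by apply: subset_trans (HiH i); apply/subsetP => E /setIdP[].
  have QH : Q z \subset H.
    by apply: subset_trans (HiH i); apply/subsetP => E /setIdP[].
  have dPQ : [disjoint P z & Q z].
    rewrite disjoints_subset; apply/subsetP => E /setIdP[_ zE].
    by rewrite !inE negb_and zE orbT.
  apply: (leq_card_exchange exF xL FM PH QH dPQ).
  - move=> E E' /setIdP[/setIdP[EH /eqP Ei] zE] /setDP[E'H E'Q].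
    have [//|[sumE sub_L]] := HI _ _ EH E'H.
    have E'i : #|E'| = i.
      apply/eqP; rewrite -(eqn_add2l i) -{1}Ei -eqSS sumE -/l.
      by rewrite i2.
    have zE' : z \notin E'.
      by apply: contra E'Q => zE'; rewrite 2!inE E'H E'i eqxx.
    by have := subsetP sub_L _ zL; rewrite inE (negPf zE) (negPf zE').
  - by move=> E /setIdP[/Hi_card].
  - by move=> E /setIdP[/Hi_card].
have sumP : \sum_(z in L) #|P z| = #|Hi i| * a.
  rewrite double_count -sum_nat_const; apply: eq_bigr => E EHi.
  have cardLE := cardsDS (HL _ (subsetP (HiH i) _ EHi)).
  rewrite (Hi_card _ _ EHi) in cardLE; rewrite -[RHS]cardLE.
  by apply: eq_card => z; rewrite inE in_setD andbC.
have sumQ : \sum_(z in L) #|Q z| = #|Hi i| * i.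
  rewrite double_count -sum_nat_const; apply: eq_bigr => E EHi.
  have EL := HL _ (subsetP (HiH i) _ EHi).
  rewrite -[RHS](Hi_card _ _ EHi); apply: eq_card => z; rewrite inE andbC.
  by apply: andb_idr; apply: (subsetP EL).
have leX : #|Hi i| * (a * v a.+1 r) <= #|Hi i| * (i * v a r).
  rewrite !mulnA -sumP -sumQ !big_distrl /=; apply: leq_sum => z zL.
  exact: leq_trans (leq_addr _ _) (X z zL).
have [lt_v|[a2 r0 le_v]] := partial_derangements_middle a_gt0 tar.
  by move: leX; rewrite leqNgt ltn_pmul2l // ia lt_v.
(* Now [i = t.+1], so the tie-breaking term in [X] makes each inequality strict; where [P z] is
   empty, [Q z] is all of [Hi i] and the right side is positive. *)
suff : #|Hi i| * (a * v a.+1 r) < #|Hi i| * (i * v a r).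
  by rewrite ltn_pmul2l // ia ltnNge le_v.
have [z0 z0L] : exists z, z \in L by apply/card_gt0P; rewrite -/l; lia.
have ltX z : z \in L -> #|P z| * v a.+1 r < #|Q z| * v a r.
  move=> zL; have := X z zL.
  have -> : i == t.+1 by apply/eqP; lia.
  have -> : t < i by lia.
  have [P0 _|_] := eqVneq (P z) set0; last by rewrite /= addn1.
  rewrite P0 cards0 mul0n muln_gt0 partial_derangements_gt0 ?a2 // andbT.
  apply: leq_trans h_gt0 (subset_leq_card _).
  apply/subsetP => E EHi; rewrite inE EHi /=; apply/negPn/negP => zE.
  by have := in_set0 E; rewrite -P0 inE EHi zE.
rewrite !mulnA -sumP -sumQ !big_distrl /= (bigD1 z0) //= [X in _ < X](bigD1 z0) //=.
rewrite -addSn; apply: leq_add; first exact: ltX.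
by apply: leq_sum => z /andP[zL _]; apply/ltnW/ltX.
Qed.

Lemma maximal_contains_t_set (n t : nat) (F : {set {set 'I_n}}) :
    0 < t -> 2 * t + 1 <= n -> maximal_t_intersecting t F ->
  exists2 S, S \in F & #|S| = t.
Proof.
move=> t_gt0 n_t Fmax.
have [/exists_inP[S SF /eqP St]|/exists_inPn noS] :=
    boolP [exists S in F, #|S| == t]; first by exists S.
have Ft : {in F, forall B : {set 'I_n}, t < #|B|}.
  move=> B BF; rewrite ltn_neqAle eq_sym noS //=.
  by have := t_intersectingP Fmax.1 _ _ BF BF; rewrite setIid.
by have [G /no_extremal[]] := extremal_exists Fmax Ft.
Qed.

(** A best family contains a [t]-set [S]; all its members meet [S] in [t] elements and so contain
    it. *)
Lemma card_perms_t_intersecting (n t : nat) (F : {set {set 'I_n}}) :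
    0 < t -> 2 * t + 1 <= n -> t_intersecting t F ->
  #|perms_fixing_in F| <= (n - t)`!.
Proof.
move=> t_gt0 n_t FI.
case: (arg_maxnP (fun G : {set {set 'I_n}} => #|perms_fixing_in G|) FI) => G GI Gmax.
have Gmaximal : maximal_t_intersecting t G by [].
have [S SG St] := maximal_contains_t_set t_gt0 n_t Gmaximal.
apply: leq_trans (Gmax F FI) _.
rewrite -St -[n in n - _]card_ord -card_perms_star.
apply/subset_leq_card/subsetP => s; rewrite !inE => sG.
have := t_intersectingP GI _ _ SG sG; rewrite -St => le_S.
by apply/setIidPl/eqP; rewrite eqEcard subsetIl.
Qed.

(** * Common cycles *)

(** Agreement on [C] makes [C] an orbit of [u] too and determines the cycle, so the set alone
    records it. *)
Definition common_orbits (T : finType) (s u : {perm T}) : {set {set T}} :=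
  [set C in porbits s | [forall z in C, s z == u z]].

Lemma mem_porbit_perm (T : finType) (s : {perm T}) (x z : T) :
  (s z \in porbit s x) = (z \in porbit s x).
Proof.
have := porbit_perm s 1 z; rewrite expg1 => E.
by rewrite porbit_sym E porbit_sym.
Qed.

Lemma porbit_sub (T : finType) (s : {perm T}) (D : {set T}) (x : T) :
  x \in D -> {in D, forall z, s z \in D} -> porbit s x \subset D.
Proof.
move=> xD sD; apply/subsetP => _ /porbitP[k ->].
by elim: k => [|k IH]; rewrite ?perm1 // expgSr permM sD.
Qed.

Lemma porbits_eq (T : finType) (s : {perm T}) (C : {set T}) (x : T) :
  C \in porbits s -> x \in C -> C = porbit s x.
Proof.
by move=> /imsetP[z _ ->] xz; apply/esym/eqP; rewrite eq_porbit_mem.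
Qed.

Lemma eq_porbit_on (T : finType) (s u : {perm T}) (x : T) :
  {in porbit s x, s =1 u} -> porbit u x = porbit s x.
Proof.
move=> su; have iter_su k : (u ^+ k)%g x = (s ^+ k)%g x.
  by elim: k => // k IH; rewrite !expgSr !permM IH su ?mem_porbit.
by apply/setP => y; apply/porbitP/porbitP => -[k ->]; exists k.
Qed.

Lemma common_orbitsP (T : finType) (s u : {perm T}) (C : {set T}) :
  reflect (C \in porbits s /\ {in C, s =1 u}) (C \in common_orbits s u).
Proof.
apply: (iffP setIdP) => [[Cs /forall_inP su]|[Cs su]]; split=> //.
  by move=> z /su/eqP.
by apply/forall_inP => z /su/eqP.
Qed.

Lemma common_orbits_in (T : finType) (s u : {perm T}) (C : {set T}) :
  C \in common_orbits s u -> C \in porbits u.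
Proof.
move=> /common_orbitsP[/imsetP[x _ ->] su].
by rewrite -(eq_porbit_on su) imset_f.
Qed.

Lemma common_orbitsC (T : finType) (s u : {perm T}) :
  common_orbits s u = common_orbits u s.
Proof.
suff sub (s' u' : {perm T}) : common_orbits s' u' \subset common_orbits u' s'.
  by apply/eqP; rewrite eqEsubset !sub.
apply/subsetP => C Csu; apply/common_orbitsP; split.
  exact: common_orbits_in Csu.
by case/common_orbitsP: Csu => _ su z /su.
Qed.

Lemma card_common_cycles (n : nat) (s u : 'S_n) :
  #|cycles s :&: cycles u| = #|common_orbits s u|.
Proof.
(* [restr_permE] is available only for permutations that stabilize [C]. *)
have stab_orbit (p : 'S_n) C : C \in porbits p -> p \in 'N(C | 'P)%g.
  move=> /imsetP[x _ ->]; apply/astabsP => z.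
  by rewrite /= apermE mem_porbit_perm.
rewrite -(card_imset (f := fun C => (C, restr_perm C s))); last first.
  by move=> C D [].
apply: eq_card => -[C p]; rewrite inE; apply/andP/imsetP.
  case=> /imsetP[D Ds [-> ->]] /imsetP[E Eu [eDE]].
  rewrite -eDE in Eu *; move/permP => eq_restr.
  exists D => //; apply/common_orbitsP; split=> // z zD.
  have := eq_restr z; rewrite !restr_permE //; exact: stab_orbit.
case=> D Dsu [-> ->]; have /common_orbitsP[Ds su] := Dsu.
split; first exact: imset_f.
have Du := common_orbits_in Dsu; apply/imsetP; exists D => //.
congr (_, _); apply/permP => z; case zD: (z \in D).
  by rewrite !restr_permE ?stab_orbit //; apply: su.
by rewrite !(out_perm (restr_perm_on _ _)) // zD.
Qed.

(** Orbits are disjoint, so a set meeting all of them is at least as large as their number. *)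
Lemma card_common_orbits_le (T : finType) (s u : {perm T}) (S : {set T}) :
    {in common_orbits s u, forall C : {set T}, exists2 z, z \in C & z \in S} ->
  #|common_orbits s u| <= #|S|.
Proof.
move=> CS; apply: leq_trans (leq_imset_card (porbit s) S).
apply/subset_leq_card/subsetP => C Csu; have [z zC zS] := CS C Csu.
have /common_orbitsP[Cs _] := Csu.
by rewrite (porbits_eq Cs zC) imset_f.
Qed.

(** * Splitting a point off its cycle *)

(** Products act from left to right: for [y = s x], the point [x] becomes fixed and its predecessor
    goes to [y]. Keeping [y] as a parameter makes the map an involution. *)
Definition split_off (T : finType) (x y : T) (s : {perm T}) : {perm T} :=
  (s * tperm x y)%g.

Lemma split_offK (T : finType) (x y : T) : involutive (split_off x y).
Proof. by move=> s; rewrite /split_off -mulgA tperm2 mulg1. Qed.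

Lemma split_off_fix (T : finType) (x y : T) (s : {perm T}) :
  s x = y -> split_off x y s x = x.
Proof. by rewrite permM => ->; rewrite tpermR. Qed.

Lemma split_off_id (T : finType) (x y z : T) (s : {perm T}) :
  s z != x -> s z != y -> split_off x y s z = s z.
Proof. by move=> zx zy; rewrite permM tpermD // eq_sym. Qed.

Lemma porbit_split_off (T : finType) (x y z : T) (s : {perm T}) :
  x != y -> s x = y -> z != x ->
  porbit (split_off x y s) z = porbit s z :\ x.
Proof.
move=> xy sx zx; set u := split_off x y s; set O := porbit u z.
have step w : w != x -> u w = if s w == x then y else s w.
  move=> wx; rewrite permM; case: eqP => [->|/eqP swx]; first by rewrite tpermL.
  by rewrite tpermD 1?eq_sym // -sx (inj_eq perm_inj).
have subO : O \subset porbit s z :\ x.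
  apply: porbit_sub => [|w]; first by rewrite !inE zx porbit_id.
  rewrite !inE => /andP[wx wz]; rewrite step //.
  case: (s w =P x) => [swx|/eqP swx]; last by rewrite swx mem_porbit_perm.
  by rewrite eq_sym xy -sx mem_porbit_perm -swx mem_porbit_perm.
have Ox w : w \in O -> w != x by move/(subsetP subO); rewrite !inE => /andP[].
apply/eqP; rewrite eqEsubset subO /=; apply/subsetP => w.
rewrite !inE => /andP[wx wz].
(* Putting [x] back when [y] is in [O] yields a set closed under [s]. *)
pose D := O :|: [set v | (v == x) && (y \in O)].
suff /subsetP/(_ w wz) : porbit s z \subset D.
  by rewrite !inE (negPf wx) /= orbF.
apply: porbit_sub => [|v]; first by rewrite inE porbit_id.
rewrite !inE => /orP[vO|/andP[/eqP-> yO]]; last by rewrite sx yO.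
have := step _ (Ox _ vO); case: (s v =P x) => [-> uv|_ uv].
  by rewrite -uv mem_porbit_perm vO orbT.
by rewrite -uv mem_porbit_perm vO.
Qed.

(** Removing [x] from common orbits is injective, since none of them is reduced to [x]. *)
Lemma common_orbits_split_off2 (T : finType) (x y : T) (s u : {perm T}) :
    x != y -> s x = y -> u x = y ->
  #|common_orbits s u| <= #|common_orbits (split_off x y s) (split_off x y u)|.
Proof.
move=> xy sx ux.
have pick_pt C : C \in porbits s -> exists2 z, z \in C & z != x.
  move=> /imsetP[z _ ->]; case: (eqVneq z x) => [->|zx].
    by exists y; rewrite ?(eq_sym y) // -sx mem_porbit_perm porbit_id.
  by exists z; rewrite ?porbit_id.
rewrite -(card_in_imset (f := fun C : {set T} => C :\ x)); last first.
  move=> C D /common_orbitsP[Cs _] /common_orbitsP[Ds _] CD.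
  have [z zC zx] := pick_pt C Cs.
  have : z \in C :\ x by rewrite !inE zx.
  rewrite (CD : C :\ x = D :\ x) inE => /andP[_ zD].
  by rewrite (porbits_eq Cs zC) (porbits_eq Ds zD).
apply/subset_leq_card/subsetP => _ /imsetP[C /common_orbitsP[Cs su] ->].
have [z zC zx] := pick_pt C Cs; apply/common_orbitsP; split.
  by rewrite {1}(porbits_eq Cs zC) -(porbit_split_off xy sx zx) imset_f.
by move=> w; rewrite inE => /andP[_ wC]; rewrite !permM su.
Qed.

(** The permutations disagree at [x], so a common orbit avoids [x] and is left intact. *)
Lemma common_orbits_split_off1 (T : finType) (x y : T) (s u : {perm T}) :
    s x = y -> u x != y ->
  common_orbits s u \subset common_orbits (split_off x y s) u.
Proof.
move=> sx ux; apply/subsetP => C /common_orbitsP[Cs su].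
have xC : x \notin C by apply: contra ux => /su <-; rewrite sx.
have s_id : {in C, split_off x y s =1 s}.
  move=> z zC; have szC : s z \in C.
    by rewrite (porbits_eq Cs zC) mem_porbit_perm porbit_id.
  apply: split_off_id; first by apply: contraNneq xC => <-.
  rewrite -sx (inj_eq perm_inj); by apply: contraNneq xC => <-.
apply/common_orbitsP; split; last by move=> z zC; rewrite s_id // su.
have [x0 _ eqC] := imsetP Cs; rewrite eqC -(@eq_porbit_on _ s (split_off x y s)).
  exact: imset_f.
by rewrite -eqC => z /s_id.
Qed.

(** A common orbit avoids [x], which [s] moves and [split_off x y u] fixes; being an orbit of [s],
    it avoids [y] as well, so neither multiplication by the transposition affects it. *)
Lemma common_orbits_split_offC (T : finType) (x y : T) (s u : {perm T}) :
    x != y -> s x = y -> u x = y ->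
  common_orbits s (split_off x y u) \subset common_orbits (split_off x y s) u.
Proof.
move=> xy sx ux; have ux' := split_off_fix ux.
have ux'y : split_off x y u x != y by rewrite ux'.
apply/subsetP => C Csu; have /common_orbitsP[Cs su] := Csu.
have /common_orbitsP[Cs' su'] := subsetP (common_orbits_split_off1 sx ux'y) _ Csu.
have xC : x \notin C.
  by apply: contra xy => /su; rewrite sx ux' => ->.
apply/common_orbitsP; split=> // z zC; rewrite su' //.
have szC : s z \in C.
  by rewrite (porbits_eq Cs zC) mem_porbit_perm porbit_id.
rewrite -[u in RHS](split_offK x y) [RHS]split_off_id // -su //.
  by apply: contraNneq xC => <-.
by rewrite -sx (inj_eq perm_inj); apply: contraNneq xC => <-.
Qed.

(** Allowing [s == u] gives a relation on all pairs, as [compress_pairwise] requires. *)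
Definition cycle_related (T : finType) (t : nat) (s u : {perm T}) : bool :=
  (s == u) || (t <= #|common_orbits s u|).

Definition compress_cycles (T : finType) (x y : T) (A : {set {perm T}}) :=
  compress (fun s : {perm T} => s x == y) (split_off x y) A.

Lemma compress_cycles_related (T : finType) (t : nat) (x y : T)
    (A : {set {perm T}}) :
    x != y -> {in A &, forall s u : {perm T}, cycle_related t s u} ->
  {in compress_cycles x y A &, forall s u : {perm T}, cycle_related t s u}.
Proof.
move=> xy; apply: compress_pairwise.
- by move=> s u; rewrite /cycle_related eq_sym common_orbitsC.
- move=> s u /eqP sx /eqP ux /orP[/eqP->|le_t]; rewrite /cycle_related ?eqxx //.
  by rewrite (leq_trans le_t) ?orbT // common_orbits_split_off2.
- move=> s u /eqP sx ux /orP[/eqP eq_su|le_t].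
    by rewrite -eq_su sx eqxx in ux.
  apply/orP; right; apply: leq_trans le_t (subset_leq_card _).
  exact: common_orbits_split_off1.
- move=> s u /eqP sx /eqP ux /orP[/eqP eq_su|le_t].
    by move: sx xy; rewrite eq_su split_off_fix // => ->; rewrite eqxx.
  apply/orP; right; apply: leq_trans le_t (subset_leq_card _).
  exact: common_orbits_split_offC.
Qed.

(** * Families that compress to a stabilizer *)

Lemma exists_full_cycle (T : finType) (U : {set T}) : 1 < #|U| ->
  exists c : {perm T}, [/\ ~: U \subset fixpts c,
    {in U, forall z, porbit c z = U} & {in U, forall z, c z != z}].
Proof.
move=> U1; set p := enum U; have Up : uniq p := enum_uniq U.
pose c := perm (can_inj (prev_next Up)).
have cE : c =1 next p by move=> z; rewrite permE.
have cU : {in U, forall z, porbit c z = U}.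
  move=> z zU; apply/setP => w; rewrite -(mem_enum U) -/p.
  have cyc : fcycle (next p) p := cycle_next Up.
  have zp : z \in p by rewrite mem_enum.
  rewrite -(fconnect_cycle cyc zp).
  apply/porbitP/idP => [[k ->]|/iter_findex <-].
    by rewrite permX (eq_iter cE) fconnect_iter.
  by exists (findex (next p) z w); rewrite permX (eq_iter cE).
exists c; split=> //.
  apply/subsetP => z; rewrite !inE cE => zU.
  by rewrite next_nth mem_enum (negPf zU).
move=> z zU; apply: contraTneq U1 => cz; rewrite -leqNgt -(cU z zU).
rewrite -(cards1 z); apply/subset_leq_card/porbit_sub; rewrite ?set11 //.
by move=> w /set1P->; rewrite cz set11.
Qed.

Definition stabilizer (T : finType) (S : {set T}) : {set {perm T}} :=
  [set s | S \subset fixpts s].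

(** If [s] really moved, [A] contains two permutations whose common cycles all meet [S] minus a
    point, hence fewer than [#|S|] of them. The full cycle [c] on the complement of [S] supplies
    one: its only nontrivial cycle is easily excluded. *)
Lemma compress_cycles_stabilizer (T : finType) (x y : T) (S : {set T})
    (A : {set {perm T}}) :
    x != y -> 1 < #|~: S| ->
    {in A &, forall s u : {perm T}, cycle_related #|S| s u} ->
    compress_cycles x y A = stabilizer S ->
  forall s, s \in A -> s x = y -> split_off x y s \in A.
Proof.
move=> xy cardS AR eqA s sA sx; apply/negPn/negP => s'A.
have [c [Sc orb_c cS]] := exists_full_cycle cardS.
rewrite setCK in Sc.
have fixS u z : u \in stabilizer S -> z \in S -> u z = z.
  by rewrite inE => /subsetP uS /uS; rewrite inE => /eqP.
have fixc z : z \in S -> c z = z by apply: fixS; rewrite inE.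
have mapS u z : u \in stabilizer S -> z \notin S -> u z \notin S.
  move=> uS; apply: contra => uzS; have := fixS _ _ uS uzS.
  by move/perm_inj => uz; rewrite -uz.
have s'S : split_off x y s \in stabilizer S.
  by rewrite -eqA; apply/imsetP; exists s; rewrite // /compress_elt sx eqxx s'A.
have from_A u : u \in stabilizer S ->
    u \in A /\ (u x = y -> split_off x y u \in A) \/
    [/\ split_off x y u \in A, u \notin A & u x = x].
  rewrite -eqA => /imsetP[v vA ->]; rewrite /compress_elt.
  case: ifP => [/andP[/eqP vx v'A]|nv]; [right|left].
    by rewrite split_offK split_off_fix.
  by split=> // /eqP vx; move: nv; rewrite vx => /negbFE.
have separated p u v : p \in S -> u \in A -> v \in A -> u != v ->
    ~ {in common_orbits u v, forall C : {set T}, exists2 z, z \in C & z \in S :\ p}.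
  move=> pS uA vA uv /card_common_orbits_le le_S.
  have := AR u v uA vA; rewrite /cycle_related (negPf uv) /= leqNgt => /negP[].
  by apply: leq_ltn_trans le_S _; rewrite (cardsD1 p S) pS.
have cstab : c \in stabilizer S by rewrite inE.
have common_cycle v C z : C \in common_orbits v c -> z \in C -> z \notin S -> C = ~: S.
  move=> /common_orbits_in Cc zC zS.
  by rewrite (porbits_eq Cc zC) orb_c // inE.
have common_pt (u v : {perm T}) (C : {set T}) :
    C \in common_orbits u v -> exists2 z, z \in C & u z = v z.
  case/common_orbitsP => /imsetP[z _ ->] uv; exists z; first exact: porbit_id.
  by apply: uv; apply: porbit_id.
(* For [x] outside [S], [c] moves [x] and so was in [A], while [s] exchanges [x] with a point [y] of
   [S]; the pair is [s], [c] and the point lost is [y]. *)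
have [xS|xS] := boolP (x \in S); last first.
  have cx : c x != x by apply: cS; rewrite inE.
  have cA : c \in A by case: (from_A c cstab) => [[]//|[_ _ /eqP]]; rewrite (negPf cx).
  have s_stab : s \notin stabilizer S.
    apply/negP => /from_A[[_ /(_ sx)]|[_ _ sxx]]; first by rewrite (negPf s'A).
    by rewrite -sx sxx eqxx in xy.
  have s_id z : z \in S -> z != y -> s z = z.
    move=> zS zy; rewrite -[s](split_offK x y) split_off_id (fixS _ _ s'S zS) //.
    by apply: contraNneq xS => <-.
  have yS : y \in S.
    apply: contraR s_stab => yS; rewrite inE; apply/subsetP => z zS.
    by rewrite inE s_id //; apply: contraNneq yS => <-.
  have sy : s y = x.
    by rewrite -[s](split_offK x y) permM (fixS _ _ s'S yS) tpermR.
  apply: (separated y s c) => //.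
    apply: contraTneq yS => eq_sc; rewrite -sx eq_sc.
    exact: mapS.
  move=> C Csc; have [z zC sz] := common_pt _ _ _ Csc.
  have [zS|zS] := boolP (z \in S).
    exists z => //; rewrite !inE zS andbT; apply: contraNneq xy => zy.
    by rewrite -sy -zy sz fixc.
  have eqC := common_cycle _ _ _ Csc zC zS.
  have xC : x \in C by rewrite eqC inE.
  have /common_orbitsP[_ /(_ x xC)] := Csc; rewrite sx => y_cx.
  by have := mapS _ _ cstab xS; rewrite -y_cx yS.
(* If [c] is in [A], then [s] and [c] differ at [x], and sharing the long cycle would give
   [split_off x y s = c]. Otherwise [A] contains [c'], the split-off of [c], which is compared with
   the preimage [v] of the identity. *)
case: (from_A c cstab) => [[cA _]|[c'A cA _]].
  apply: (separated x s c) => //.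
    by apply: contraNneq xy => eq_sc; rewrite -sx eq_sc fixc.
  move=> C Csc; have [z zC sz] := common_pt _ _ _ Csc.
  have [zS|zS] := boolP (z \in S).
    exists z => //; rewrite !inE zS andbT; apply: contraNneq xy => zx.
    by rewrite -sx -zx sz fixc.
  have eqC := common_cycle _ _ _ Csc zC zS.
  suff s'c : split_off x y s = c by rewrite s'c cA in s'A.
  apply/permP => w; have [wS|wS] := boolP (w \in S).
    by rewrite fixc // (fixS _ _ s'S wS).
  have /common_orbitsP[_ sc] := Csc.
  have swcw : s w = c w by apply: sc; rewrite eqC inE.
  rewrite split_off_id //.
    by apply: contraNneq (mapS _ _ cstab wS) => sw; rewrite -swcw sw.
  by rewrite -sx (inj_eq perm_inj); apply: contraNneq wS => ->.
have stab1 : 1%g \in stabilizer S.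
  by rewrite inE; apply/subsetP => z _; rewrite inE perm1.
have [v vA v_id] : exists2 v, v \in A & v = 1%g \/ v = tperm x y.
  case: (from_A _ stab1) => [[A1 _]|[A1 _ _]]; first by exists 1%g; [|left].
  by exists (tperm x y); [move: A1; rewrite /split_off mul1g|right].
set c' := split_off x y c in c'A.
have vc' w : w \notin S -> v w != c' w.
  move=> wS; have cwS := mapS _ _ cstab wS.
  have cw : c w != w by apply: cS; rewrite inE.
  have wx : w != x by apply: contraNneq wS => ->.
  have cwx : c w != x by apply: contraNneq cwS => ->.
  rewrite permM; have [wy|wy] := eqVneq w y.
    rewrite wy in cw cwx *; rewrite tpermD 1?eq_sym //.
    by case: v_id => ->; rewrite ?perm1 ?tpermR // eq_sym.
  have -> : v w = w.
    by case: v_id => ->; rewrite ?perm1 // tpermD // eq_sym.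
  have [cwy|cwy] := eqVneq (c w) y; first by rewrite cwy tpermR.
  by rewrite tpermD 1?eq_sym.
have [w0 w0S] : exists w, w \notin S.
  have /card_gt0P[w] : 0 < #|~: S| by apply: leq_trans cardS.
  by rewrite inE; exists w.
apply: (separated x v c') => //.
  by apply: contraNneq (vc' _ w0S) => ->.
move=> C Cvc; have /common_orbitsP[Cv vc] := Cvc.
have CS z : z \in C -> z \in S.
  by move=> zC; apply: contraLR isT => /vc'; rewrite vc // eqxx.
have [z zC _] := common_pt _ _ _ Cvc.
have [zx|zx] := eqVneq z x; last by exists z; rewrite // !inE zx CS.
(* As [c' x = y], a common cycle through [x] also meets [S] at [y]. *)
have yC : y \in C.
  have Cc' := common_orbits_in Cvc; have xC : x \in C by rewrite -zx.
  rewrite (porbits_eq Cc' xC); have <- : c' x = y.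
    by rewrite permM fixc // tpermL.
  by rewrite mem_porbit_perm porbit_id.
by exists y; rewrite // !inE CS // eq_sym xy.
Qed.

(** * From cycles to fixed points *)

Lemma fixpts_split_off (T : finType) (x : T) (s : {perm T}) :
  s x != x -> fixpts s \proper fixpts (split_off x (s x) s).
Proof.
move=> sx; apply/properP; split; last first.
  by exists x; rewrite inE // (split_off_fix (erefl (s x))).
apply/subsetP => z; rewrite !inE => /eqP sz.
have zx : z != x by apply: contraNneq sx => <-; rewrite sz.
by rewrite split_off_id ?sz // -[z in z != _]sz (inj_eq perm_inj).
Qed.

(** Induction on the number of points moved by [s]. Once [s] and [u] agree only at common fixed
    points, every common cycle is a fixed point. *)
Lemma card_common_fixpts (T : finType) (t : nat) (A : {set {perm T}}) :
    {in A &, forall s u : {perm T}, cycle_related t s u} ->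
    (forall s x, s \in A -> s x != x -> split_off x (s x) s \in A) ->
  {in A &, forall s u : {perm T}, s != u -> t <= #|fixpts s :&: fixpts u|}.
Proof.
move=> AR Asplit s u; have [k] := ubnP #|~: fixpts s|.
elim: k s => // k IH s /ltnSE-le_k sA uA su.
have [/existsP[x /andP[/eqP sux sx]]|/existsPn common_fix] :=
    boolP [exists x, (s x == u x) && (s x != x)]; last first.
  have := AR s u sA uA; rewrite /cycle_related (negPf su) /= => /leq_trans; apply.
  apply: card_common_orbits_le => C /common_orbitsP[/imsetP[z _ ->] agree].
  exists z; first exact: porbit_id.
  have sz := agree z (porbit_id _ _); have := common_fix z.
  by rewrite !inE -sz eqxx negbK andbb.
have su' : split_off x (s x) s != u.
  by apply: contraNneq sx => eq_u; rewrite sux -eq_u split_off_fix.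
have lt_fix : ~: fixpts (split_off x (s x) s) \proper ~: fixpts s.
  by rewrite properC fixpts_split_off.
apply: (@leq_trans #|fixpts (split_off x (s x) s) :&: fixpts u|).
  apply: IH => //; last exact: Asplit.
  exact: leq_trans (proper_card lt_fix) le_k.
apply/subset_leq_card/subsetP => z; rewrite !inE => /andP[s'z /eqP uz].
rewrite uz eqxx andbT.
(* A common fixed point after splitting is neither [x] nor [s x], since [u x = s x != x]; hence [s]
   fixed it before. *)
have zx : z != x by apply: contraNneq sx => zx; rewrite sux -zx uz.
have zsx : z != s x.
  by apply: contraNneq zx => zsx; rewrite -(inj_eq (@perm_inj _ u)) uz -sux zsx.
move: s'z; rewrite permM; have [->|_|//] := tpermP x (s x) (s z).
  by rewrite eq_sym (negPf zsx).
by rewrite eq_sym (negPf zx).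
Qed.

Lemma card_stabilizer (T : finType) (S : {set T}) :
  #|stabilizer S| = (#|T| - #|S|)`!.
Proof. exact: card_fixing. Qed.

Lemma split_off_closed_family (n t : nat) (A : {set 'S_n}) :
    0 < t -> 2 * t + 1 <= n -> 1 < #|A| ->
    {in A &, forall s u : 'S_n, cycle_related t s u} ->
    (forall s x, s \in A -> s x != x -> split_off x (s x) s \in A) ->
  #|A| <= (n - t)`! /\
  (#|A| = (n - t)`! -> exists2 S : {set 'I_n}, #|S| = t & A = stabilizer S).
Proof.
move=> t_gt0 n_t A1 AR Asplit.
have fixI := card_common_fixpts AR Asplit.
pose F := [set fixpts s | s in A].
have FI : t_intersecting t F.
  apply/t_intersectingP => _ _ /imsetP[s sA ->] /imsetP[u uA ->].
  have [<-|su] := eqVneq s u; last exact: fixI.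
  (* A second member is needed to see that [s] itself has [t] fixed points. *)
  have /card_gt0P[v] : 0 < #|A :\ s| by move: A1; rewrite (cardsD1 s) sA.
  rewrite !inE => /andP[vs vA]; rewrite setIid.
  apply: leq_trans (fixI s v sA vA _) (subset_leq_card (subsetIl _ _)).
  by rewrite eq_sym.
have AF : A \subset perms_fixing_in F.
  by apply/subsetP => s sA; rewrite inE imset_f.
have leF := card_perms_t_intersecting t_gt0 n_t FI.
split; first exact: leq_trans (subset_leq_card AF) leF.
move=> cardA; have Fmax : maximal_t_intersecting t F.
  split=> // G GI; apply: leq_trans (card_perms_t_intersecting t_gt0 n_t GI) _.
  by rewrite -cardA subset_leq_card.
have [S SF St] := maximal_contains_t_set t_gt0 n_t Fmax.
exists S => //; apply/eqP; rewrite eqEcard card_stabilizer card_ord St cardA leqnn.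
rewrite andbT; apply/subsetP => s sA; rewrite inE.
have := t_intersectingP FI _ _ SF (imset_f (@fixpts _) sA); rewrite -St => le_S.
by apply/setIidPl/eqP; rewrite eqEcard subsetIl.
Qed.

(** Each effective compression raises the total number of fixed points, so the induction ends at a
    closed family. A family still moving cannot attain equality, by [compress_cycles_stabilizer]. *)
Lemma cycle_related_family (n t : nat) (A : {set 'S_n}) :
    0 < t -> 2 * t + 1 <= n -> 1 < #|A| ->
    {in A &, forall s u : 'S_n, cycle_related t s u} ->
  #|A| <= (n - t)`! /\
  (#|A| = (n - t)`! -> exists2 S : {set 'I_n}, #|S| = t & A = stabilizer S).
Proof.
move=> t_gt0 n_t; pose w (B : {set 'S_n}) := \sum_(s in B) #|fixpts s|.
have [k] := ubnP (w setT - w A).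
elim: k A => // k IH A /ltnSE-le_k A1 AR.
have [/exists_inP[s sA /existsP[x /andP[sx s'A]]]|closedA] :=
  boolP [exists s in A, exists x, (s x != x) && (split_off x (s x) s \notin A)];
  last first.
  apply: split_off_closed_family => // s x sA sx.
  have /exists_inPn/(_ s sA)/existsPn/(_ x) := closedA.
  by rewrite sx negbK.
have x_sx : x != s x by rewrite eq_sym.
have split_inj := inv_inj (split_offK x (s x)).
set A' := compress_cycles x (s x) A.
have cardA' : #|A'| = #|A| by apply: card_compress.
have wAA' : w A < w A'.
  apply: (@sum_compress_lt _ _ _ _ _ s) => // u /eqP ux.
  by rewrite -ux; apply/proper_card/fixpts_split_off; rewrite ux.
have wA'T : w A' <= w setT by apply/leq_sum_subset/subsetT.
have [leA' eqA'] : #|A'| <= (n - t)`! /\ (#|A'| = (n - t)`! ->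
    exists2 S : {set 'I_n}, #|S| = t & A' = stabilizer S).
  apply: IH; [lia|by rewrite cardA'|exact: compress_cycles_related].
rewrite -cardA'; split=> // /eqA'[S St A'S].
have := s'A; rewrite (compress_cycles_stabilizer x_sx _ _ A'S) ?St //.
have := cardsC S; rewrite St card_ord; lia.
Qed.

(** * Point stabilizers and conclusion *)

Lemma pt_stabilizerE (n t : nat) (a : t.-tuple 'I_n) :
  pt_stabilizer a = stabilizer [set x in a].
Proof.
apply/setP => s; rewrite !inE; apply/forallP/subsetP => sa.
  by move=> x; rewrite !inE => /tnthP[k ->].
by move=> k; have := sa (tnth a k); rewrite !inE mem_tnth => /(_ isT).
Qed.

Lemma is_pt_stabilizerP (n t : nat) (A : {set 'S_n}) :
  is_pt_stabilizer t A <-> exists2 S : {set 'I_n}, #|S| = t & A = stabilizer S.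
Proof.
split=> [[a Ua ->]|[S <- ->]].
  exists [set x in a]; last exact: pt_stabilizerE.
  by rewrite cardsE (card_uniqP Ua) size_tuple.
exists (enum_tuple (mem S)); first exact: enum_uniq.
rewrite pt_stabilizerE; congr stabilizer; apply/setP => x.
by rewrite inE mem_enum.
Qed.

Theorem theorem1p4 (n t : nat) (ht : 0 < t) (hn : 2 * t + 1 <= n)
    (A : {set 'S_n}) (hA : cycle_intersecting t A) :
  #|A| <= (n - t)`! /\ (#|A| = (n - t)`! <-> is_pt_stabilizer t A).
Proof.
(* With at most one member the intersection condition is vacuous, but [n - t >= 2] keeps [(n - t)!]
   above 1. *)
have [A1|A1] := leqP #|A| 1.
  have fact_gt1 : 1 < (n - t)`! by apply: leq_trans (fact_geq _); lia.
  split; first exact: leq_trans A1 (ltnW fact_gt1).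
  split=> [cardA|/is_pt_stabilizerP[S St AS]].
    by rewrite cardA leqNgt fact_gt1 in A1.
  by rewrite AS card_stabilizer card_ord St.
have AR : {in A &, forall s u : 'S_n, cycle_related t s u}.
  move=> s u sA uA; rewrite /cycle_related; have [//|su] := eqVneq s u.
  by rewrite -card_common_cycles; apply: hA.
have [leA eqA] := cycle_related_family ht hn A1 AR.
split=> //; split=> [/eqA|] /is_pt_stabilizerP //.
by case=> S St ->; rewrite card_stabilizer card_ord St.
Qed.
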